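(* The language preservation problem for parametric event-recording automata remains undecidable when the untimed language is defined by finite words ending in an accepting location. That is, there is no algorithm that, given as input a parametric event-recording automaton $\mathsf{A}$ with parameter set $P$ and set $F$ of accepting locations, and a parameter valuation $v : P \to \mathbb{Q}_{+}$, decides whether there exists a parameter valuation $v' : P \to \mathbb{Q}_{+}$ with $v' \neq v$ such that $\mathsf{UL}_{R}(v'(\mathsf{A})) = \mathsf{UL}_{R}(v(\mathsf{A}))$, where $\mathsf{UL}_{R}(v(\mathsf{A}))$ is the set of all (finite) untimed words associated with a finite run of $v(\mathsf{A})$ ending in an accepting location (a location in $F$).
   Context: $\mathbb{Q}_{+}$ and $\mathbb{R}_{+}$ denote the non-negative rationals and non-negative reals. Clocks are real-valued variables that evolve at the same rate. For a set $X$ of clocks, a clock valuation is a function $\mu : X \to \mathbb{R}_{+}$; $\vec{0}$ is the valuation assigning $0$ to all clocks; for $d \in \mathbb{R}_{+}$, $(\mu+d)(x) = \mu(x)+d$ for all $x \in X$; for $x \in X$, $[\mu]_x$ is the valuation with $[\mu]_x(x) = 0$ and $[\mu]_x(x') = \mu(x')$ for $x' \neq x$. Parameters are unknown rational constants; for a set $P$ of parameters, a parameter valuation is a function $v : P \to \mathbb{Q}_{+}$. A guard $g$ over $X \cup P$ is a conjunction of inequalities $x \bowtie \eta$ with $x \in X$, $\eta$ either a parameter in $P$ or a constant in $\mathbb{Z}$, and ${\bowtie} \in \{<,\leq,\geq,>\}$. $v(g)$ is $g$ with each parameter $p$ replaced by $v(p)$. A parametric event-recording automaton (PERA) is a tuple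 $\mathsf{A} = (\Sigma, L, l_0, P, I, E)$ where $\Sigma$ is a finite set of actions, $L$ is a finite set of locations, $l_0 \in L$ is the initial location, $P$ is a finite set of parameters, $I$ assigns to every $l \in L$ a guard $I(l)$ (the invariant), and $E$ is a finite set of edges $e = (l, g, a, l')$ with $l,l' \in L$, $a \in \Sigma$ and $g$ a guard. Here it additionally comes with a set $F \subseteq L$ of accepting locations. The clocks are $X_\Sigma = \{x_a : a \in \Sigma\}$, one clock $x_a$ per action $a$; guards are over $X_\Sigma \cup P$, and $x_a$ is implicitly reset exactly on transitions labeled with $a$. For a parameter valuation $v$, $v(\mathsf{A})$ denotes the (non-parametric) automaton obtained by replacing each parameter $p$ by $v(p)$. Semantics of $v(\mathsf{A})$: the states are $S = \{(l,\mu) \in L \times \mathbb{R}_{+}^{|X_\Sigma|} : \mu \models v(I(l))\}$, and the initial state is $s_0 = (l_0, \vec{0})$. Discrete transitions: $(l,\mu) \xrightarrow{e} (l',\mu')$ if $(l,\mu),(l',\mu') \in S$ and there is $e = (l,g,a,l') \in E$ with $\mu' = [\mu]_{x_a}$ and $\mu \models v(g)$. Delay transitions: $(l,\mu) \xrightarrow{d} (l,\mu+d)$ for $d \in \mathbb{R}_{+}$ if $(l,\mu+d') \in S$ for all $d' \in [0,d]$. A run is a finite or infinite sequence $s_0 \xrightarrow{(d_0,e_0)} s_1 \xrightarrow{(d_1,e_1)} \cdots$ starting in the initial state, where each step is a delay $d_i$ followed by a discrete transition along $e_i$. Its untimed word is $a_0 a_1 \cdots$, where $a_i$ is the action of $e_i$.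 *)

(* Defs.v *)
From HB Require Import structures.
From mathcomp Require Import all_boot all_order all_algebra.
From mathcomp Require Import interval_inference.
From mathcomp Require Import boolp classical_sets reals.

Set Implicit Arguments.
Unset Strict Implicit.
Unset Printing Implicit Defensive.

Import Order.TTheory GRing.Theory Num.Theory.

Local Open Scope ring_scope.

Variant comparison := CmpLt | CmpLe | CmpGe | CmpGt.

Definition nat_of_comparison (c : comparison) : nat :=
  match c with CmpLt => 0 | CmpLe => 1 | CmpGe => 2 | CmpGt => 3 end.

Definition comparison_of_nat (n : nat) : comparison :=
  match n with 0 => CmpLt | 1 => CmpLe | 2 => CmpGe | _ => CmpGt end.

Lemma nat_of_comparisonK : cancel nat_of_comparison comparison_of_nat.
Proof. by case. Qed.

HB.instance Definition _ := Equality.copy comparison (can_type nat_of_comparisonK).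

(* A conjunction of inequalities [x_a >< b], where [(a, c, b)] stands for one of
   them.  There is one clock per action, so a clock is named by its action. *)
Definition guard (Sigma : Type) (B : Type) : Type :=
  seq (Sigma * comparison * B).

(* The edge [(l, g, a, l')]. *)
Definition edge (Sigma L B : Type) : Type := (L * guard Sigma B * Sigma * L)%type.

Definition edge_guard Sigma L B (e : edge Sigma L B) : guard Sigma B := e.1.1.2.
Definition edge_source Sigma L B (e : edge Sigma L B) : L := e.1.1.1.
Definition edge_action Sigma L B (e : edge Sigma L B) : Sigma := e.1.2.
Definition edge_target Sigma L B (e : edge Sigma L B) : L := e.2.

Record era (Sigma L : finType) (B : eqType) := Era {
  era_init : L;
  era_inv : {ffun L -> guard Sigma B};
  era_edges : seq (edge Sigma L B);
  era_acc : {set L}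
}.

Definition pera (Sigma L P : finType) := era Sigma L (P + int)%type.

Definition param_valuation (P : finType) := {ffun P -> {nonneg rat}}.

Definition inst_bound (P : finType) (v : param_valuation P) (b : P + int) : rat :=
  match b with inl p => (v p)%:num | inr z => z%:~R end.

Definition inst_guard (Sigma P : finType) (v : param_valuation P)
    (g : guard Sigma (P + int)) : guard Sigma rat :=
  [seq (k.1.1, k.1.2, inst_bound v k.2) | k <- g].

Definition inst_edge (Sigma L P : finType) (v : param_valuation P)
    (e : edge Sigma L (P + int)) : edge Sigma L rat :=
  (edge_source e, inst_guard v (edge_guard e), edge_action e, edge_target e).

(* [inst v A] is the non-parametric automaton v(A). *)
Definition inst (Sigma L P : finType) (v : param_valuation P) (A : pera Sigma L P) :
    era Sigma L rat :=
  Era (era_init A) [ffun l => inst_guard v (era_inv A l)]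
      [seq inst_edge v e | e <- era_edges A] (era_acc A).

Section Semantics.
Variables (R : realType) (Sigma L : finType).

Definition clock_valuation := Sigma -> {nonneg R}.

Definition cv0 : clock_valuation := fun=> 0%:nng.

Definition cv_delay (mu : clock_valuation) (d : {nonneg R}) : clock_valuation :=
  fun x => ((mu x)%:num + d%:num)%:nng.

Definition cv_reset (mu : clock_valuation) (a : Sigma) : clock_valuation :=
  fun x => if x == a then 0%:nng else mu x.

Definition compare (c : comparison) (x y : R) : bool :=
  match c with
  | CmpLt => x < y
  | CmpLe => x <= y
  | CmpGe => x >= y
  | CmpGt => x > y
  end.

Definition satisfies (mu : clock_valuation) (g : guard Sigma rat) : bool :=
  all (fun k => compare k.1.2 (mu k.1.1)%:num (ratr k.2)) g.

Definition configuration : Type := (L * clock_valuation)%type.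

Variable A : era Sigma L rat.

Definition is_state (s : configuration) : bool := satisfies s.2 (era_inv A s.1).

Definition initial_state : configuration := (era_init A, cv0).

Definition delay_step (s : configuration) (d : {nonneg R}) (s' : configuration) :
    Prop :=
  s' = (s.1, cv_delay s.2 d) /\
  forall d' : {nonneg R}, d'%:num <= d%:num -> is_state (s.1, cv_delay s.2 d').

Definition discrete_step (s : configuration) (e : edge Sigma L rat)
    (s' : configuration) : Prop :=
  [/\ is_state s /\ is_state s',
      e \in era_edges A,
      edge_source e = s.1 /\ edge_target e = s'.1,
      s'.2 = cv_reset s.2 (edge_action e) &
      satisfies s.2 (edge_guard e)].

(* [run_from s r] : from [s], the list [r = [:: (d0, e0, s1); (d1, e1, s2); ...]]
   describes the steps s -(d0, e0)-> s1 -(d1, e1)-> s2 ... *)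
Fixpoint run_from (s : configuration)
    (r : seq ({nonneg R} * edge Sigma L rat * configuration)) : Prop :=
  match r with
  | [::] => True
  | (d, e, s') :: r' =>
      (exists2 s1, delay_step s d s1 & discrete_step s1 e s') /\ run_from s' r'
  end.

(* The initial configuration has to be a state, i.e., satisfy its invariant,
   also for the run of length zero. *)
Definition is_run r : Prop := is_state initial_state /\ run_from initial_state r.

Definition untimed_word (r : seq ({nonneg R} * edge Sigma L rat * configuration)) :
    seq Sigma :=
  [seq edge_action t.1.2 | t <- r].

Definition run_end (r : seq ({nonneg R} * edge Sigma L rat * configuration)) :
    configuration :=
  last initial_state [seq t.2 | t <- r].

Definition untimed_language : set (seq Sigma) :=
  [set w | exists r, [/\ is_run r, (run_end r).1 \in era_acc A &
                         untimed_word r = w]].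

End Semantics.

Arguments untimed_language R {Sigma L} A.

Definition language_preservation (R : realType) (Sigma L P : finType)
    (A : pera Sigma L P) (v : param_valuation P) : Prop :=
  exists v' : param_valuation P, v' <> v /\
    untimed_language R (inst v' A) = untimed_language R (inst v A).

(* [Inc r] increments register [r] and goes to the next instruction;
   [Dec r k] jumps to instruction [k] if register [r] is zero, and otherwise
   decrements it and goes to the next instruction.
   The machine halts when the program counter leaves the program. *)
Variant instr := Inc of nat | Dec of nat & nat.

Definition machine := seq instr.

Definition machine_config : Type := (nat * (nat -> nat))%type.

Definition set_reg (rho : nat -> nat) (r n : nat) : nat -> nat :=
  fun r' => if r' == r then n else rho r'.

Definition halted (M : machine) (c : machine_config) : bool := (size M <= c.1)%N.

Definition machine_step (M : machine) (c : machine_config) : machine_config :=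
  if halted M c then c else
  match nth (Inc 0) M c.1 with
  | Inc r => (c.1.+1, set_reg c.2 r (c.2 r).+1)
  | Dec r k => if c.2 r == 0%N then (k, c.2)
               else (c.1.+1, set_reg c.2 r (c.2 r).-1)
  end.

Definition machine_input (n : nat) : machine_config := (0%N, set_reg (fun=> 0%N) 0 n).

Definition outputs (M : machine) (n m : nat) : Prop :=
  exists t, let c := iter t (machine_step M) (machine_input n) in
            halted M c /\ c.2 0%N = m.

(* [M] halts on (the code of) every instance, with output 1 or 0 according to
   whether the answer is yes or no. *)
Definition decides (I : Type) (encode : I -> nat) (M : machine) (Q : I -> Prop) :
    Prop :=
  forall i, exists b : bool, outputs M (encode i) b /\ (b <-> Q i).

Definition algorithmically_decidable (I : Type) (encode : I -> nat)
    (Q : I -> Prop) : Prop :=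
  exists M : machine, decides encode M Q.

(* Up to renaming, the finite sets of an instance are initial segments of nat. *)
Record lp_instance := LPInstance {
  nb_actions : nat;
  nb_locations : nat;
  nb_params : nat;
  lp_pera : pera 'I_nb_actions 'I_nb_locations 'I_nb_params;
  lp_val : param_valuation 'I_nb_params
}.

(* [CodeSeq.code] is a (computable) bijection from [seq nat] to [nat]. *)
Notation code := CodeSeq.code.

Definition encode_int (z : int) : nat :=
  match z with Posz n => code [:: 0; n]%N | Negz n => code [:: 1; n]%N end.

Definition encode_rat (q : rat) : nat :=
  code [:: encode_int (numq q); encode_int (denq q)].

Definition encode_bound p (b : 'I_p + int) : nat :=
  match b with
  | inl i => code [:: 0; nat_of_ord i]%N
  | inr z => code [:: 1; encode_int z]%N
  end.

Definition encode_guard n p (g : guard 'I_n ('I_p + int)) : nat :=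
  code [seq code [:: nat_of_ord k.1.1; nat_of_comparison k.1.2; encode_bound k.2]
       | k <- g].

Definition encode_edge n m p (e : edge 'I_n 'I_m ('I_p + int)) : nat :=
  code [:: nat_of_ord (edge_source e); encode_guard (edge_guard e);
           nat_of_ord (edge_action e); nat_of_ord (edge_target e)].

Definition encode_pera n m p (A : pera 'I_n 'I_m 'I_p) : nat :=
  code [:: n; m; p; nat_of_ord (era_init A);
           code [seq encode_guard (era_inv A l) | l <- enum 'I_m];
           code [seq encode_edge e | e <- era_edges A];
           code [seq nat_of_ord l | l <- enum (era_acc A)]].

Definition encode_valuation p (v : param_valuation 'I_p) : nat :=
  code [seq encode_rat (v i)%:num | i <- enum 'I_p].

Definition encode_instance (i : lp_instance) : nat :=
  code [:: encode_pera (lp_pera i); encode_valuation (lp_val i)].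

Lemma code_inj : injective code.
Proof. exact: can_inj CodeSeq.codeK. Qed.

Lemma encode_int_inj : injective encode_int.
Proof. by move=> [x|x] [y|y] /code_inj // [->]. Qed.

Lemma encode_rat_inj : injective encode_rat.
Proof.
move=> x y /code_inj [/encode_int_inj hn /encode_int_inj hd].
by rewrite -(divq_num_den x) -(divq_num_den y) hn hd.
Qed.

Lemma encode_bound_inj p : injective (@encode_bound p).
Proof.
move=> [x|x] [y|y] /code_inj // [] h; first by rewrite (ord_inj h).
by rewrite (encode_int_inj h).
Qed.

Lemma encode_guard_inj n p : injective (@encode_guard n p).
Proof.
move=> g h /code_inj; apply: inj_map => -[[a c] b] [[a' c'] b'] /code_inj /= [].
by move=> /ord_inj -> /(can_inj nat_of_comparisonK) -> /encode_bound_inj ->.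
Qed.

Lemma encode_edge_inj n m p : injective (@encode_edge n m p).
Proof.
move=> [[[l g] a] k] [[[l' g'] a'] k'] /code_inj [].
rewrite /edge_source /edge_guard /edge_action /edge_target /=.
by move=> /ord_inj -> /encode_guard_inj -> /ord_inj -> /ord_inj ->.
Qed.

Lemma encode_pera_inj n m p : injective (@encode_pera n m p).
Proof.
move=> [i I E F] [i' I' E' F'] /code_inj [] /=.
move=> /ord_inj -> /code_inj hI /code_inj hE /code_inj hF.
have -> : I = I'.
  apply/ffunP => l; apply: encode_guard_inj.
  by move/eq_in_map: hI => /(_ l); apply; rewrite mem_enum.
rewrite (inj_map (@encode_edge_inj n m p) hE).
have -> // : F = F'.
by apply/setP => l; rewrite -(mem_enum F) (inj_map (@ord_inj _) hF) mem_enum.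
Qed.

Lemma encode_valuation_inj p : injective (@encode_valuation p).
Proof.
move=> v w /code_inj h; apply/ffunP => i; apply/val_inj/encode_rat_inj.
by move/eq_in_map: h => /(_ i); apply; rewrite mem_enum.
Qed.

Lemma encode_instance_inj : injective encode_instance.
Proof.
move=> [n m p A v] [n' m' p' A' v'] /code_inj [] /= hA hv.
have [en em ep] : [/\ n = n', m = m' & p = p'] by case/code_inj: hA.
subst n' m' p'.
by rewrite (encode_pera_inj hA) (encode_valuation_inj hv).
Qed.

(* Main.v *)
Require Import Defs.
From mathcomp Require Import all_boot all_order all_algebra.
From mathcomp Require Import boolp classical_sets reals.
From HB Require Import structures.
From mathcomp Require Import interval_inference.
From mathcomp Require Import lra zify.

(** A register machine D and an input n are turned into a parametric automaton A_D, which
depends on D only, and a valuation (n, 0) of its two parameters: the input and a period p.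
The words that begin with [Probe] pin the first parameter down.  The words that begin with
[Start] are all accepted if p = 0.  If p > 0 they cannot be all accepted unless D halts on
the input, and they are if moreover p is large enough.  Indeed such a word describes a
purported computation of D, and it is accepted if it is short with respect to p, or
ill-formed, or contains a halting instruction, or takes the wrong branch of a zero test.  A
run follows a single register: its value is the time that separates the events [Rec1] and
[Rec2], which recur with period p.
Hence the language of A_D is preserved from (n, 0) iff D halts on n.

Now let M decide language preservation, and let D, on input n, compute the code of the
instance made of the automaton encoded by n and of the valuation (n, 0), run M on it, and
halt iff M answers no.  Taking for n the code of A_D gives a contradiction; no universal
machine is needed since the input enters the instance through the valuation only. *)

Set Implicit Arguments.
Unset Strict Implicit.
Unset Printing Implicit Defensive.

Import Order.TTheory GRing.Theory Num.Theory.

Local Open Scope ring_scope.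

(** * Automata given by a transition function *)

Section TransitionFunction.
Variables (R : realType) (Sigma L P : finType).
Variable step : L -> Sigma -> seq (guard Sigma (P + int) * L).
Variables (init : L) (F : {set L}).

Implicit Types (v : param_valuation P) (mu : Sigma -> R) (l : L) (w : seq Sigma).

Definition guard_holds v mu (g : guard Sigma (P + int)) : bool :=
  all (fun k => compare k.1.2 (mu k.1.1) (ratr (inst_bound v k.2))) g.

(** Invariants are empty in these automata, so a run amounts to a choice of delays and edges, and
    clock values can be plain reals. *)
Fixpoint accepts v l mu w : Prop :=
  match w with
  | [::] => l \in F
  | a :: w' => exists d g l', [/\ 0 <= d, (g, l') \in step l a,
      guard_holds v (fun x => mu x + d) g &
      accepts v l' (fun x => if x == a then 0 else mu x + d) w']
  end.

Definition rank_guard (g : guard Sigma (P + int)) : guard 'I_#|Sigma| (P + int) :=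
  [seq (enum_rank k.1.1, k.1.2, k.2) | k <- g].

Definition rank_edge (x : L * Sigma * (guard Sigma (P + int) * L)) :
    edge 'I_#|Sigma| 'I_#|L| (P + int) :=
  (enum_rank x.1.1, rank_guard x.2.1, enum_rank x.1.2, enum_rank x.2.2).

(** Transport along [enum_rank], since instances have ordinals as actions and locations. *)
Definition rank_pera : pera 'I_#|Sigma| 'I_#|L| P :=
  Era (enum_rank init) [ffun=> [::]]
    [seq rank_edge (la, gl) | la <- enum {: L * Sigma}, gl <- step la.1 la.2]
    [set i | enum_val i \in F].

Lemma rank_edgeP v (e : edge 'I_#|Sigma| 'I_#|L| rat) :
  reflect (exists l a g l', (g, l') \in step l a /\
             e = (enum_rank l, inst_guard v (rank_guard g), enum_rank a, enum_rank l'))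
          (e \in era_edges (inst v rank_pera)).
Proof.
apply: (iffP mapP) => [[e0 /allpairsPdep[[l a] [[g l'] [_ gl ->]]] ->]|].
  by exists l, a, g, l'.
move=> [l [a [g [l' [gl ->]]]]]; exists (rank_edge ((l, a), (g, l'))) => //.
by apply/allpairsPdep; exists (l, a), (g, l'); rewrite mem_enum.
Qed.

Lemma guard_holds_rank v mu (nu : clock_valuation R 'I_#|Sigma|) g :
  (forall x, (nu (enum_rank x))%:num = mu x) ->
  satisfies nu (inst_guard v (rank_guard g)) = guard_holds v mu g.
Proof.
move=> numu; rewrite /satisfies /inst_guard /rank_guard !all_map.
by apply: eq_all => k /=; rewrite numu.
Qed.

Lemma rank_acc l : (enum_rank l \in era_acc rank_pera) = (l \in F).
Proof. by rewrite /rank_pera /= inE enum_rankK. Qed.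

Lemma rank_is_state v (s : configuration R 'I_#|Sigma| 'I_#|L|) :
  is_state (inst v rank_pera) s.
Proof. by rewrite /is_state !ffunE. Qed.

Lemma run_accepts v l mu (nu : clock_valuation R 'I_#|Sigma|) r :
  (forall x, (nu (enum_rank x))%:num = mu x) ->
  run_from (inst v rank_pera) (enum_rank l, nu) r ->
  (last (enum_rank l, nu) [seq t.2 | t <- r]).1 \in era_acc rank_pera ->
  accepts v l mu [seq enum_val a | a <- untimed_word r].
Proof.
elim: r l mu nu => [|[[d e] [k nu']] r IH] l mu nu numu /=.
  by rewrite rank_acc.
move=> [[s1 [-> _] [_ /rank_edgeP [l0 [a [g [l' [gl ->]]]]]]]].
rewrite /edge_source /edge_target /edge_action /edge_guard /=.
move=> [/enum_rank_inj ll0 kl'] nu'E sat rr acc; subst l0 k nu'.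
have numu' x : (cv_delay nu d (enum_rank x))%:num = mu x + d%:num.
  by rewrite /= numu.
rewrite enum_rankK; exists d%:num, g, l'; split => //.
  by move: sat; rewrite (guard_holds_rank _ _ numu').
apply: IH rr acc => x; rewrite /cv_reset (inj_eq enum_rank_inj).
by case: eqP => //= _; rewrite numu.
Qed.

Lemma accepts_run v l mu (nu : clock_valuation R 'I_#|Sigma|) w :
  (forall x, (nu (enum_rank x))%:num = mu x) -> accepts v l mu w ->
  exists r, [/\ run_from (inst v rank_pera) (enum_rank l, nu) r,
    (last (enum_rank l, nu) [seq t.2 | t <- r]).1 \in era_acc rank_pera &
    untimed_word r = [seq enum_rank a | a <- w]].
Proof.
elim: w l mu nu => [|a w IH] l mu nu numu /=.
  by move=> lF; exists [::]; split => //=; rewrite rank_acc.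
move=> [d [g [l' [d0 gl sat acc]]]].
set d' : {nonneg R} := NngNum d0.
pose nu' := cv_reset (cv_delay nu d') (enum_rank a).
have [|r [rr lr wr]] := IH l' _ nu' _ acc.
  move=> x; rewrite /nu' /cv_reset (inj_eq enum_rank_inj).
  by case: eqP => //= _; rewrite numu.
exists ((d', (enum_rank l, inst_guard v (rank_guard g), enum_rank a, enum_rank l'),
        (enum_rank l', nu')) :: r); split => //=; last by rewrite wr.
split => //; exists (enum_rank l, cv_delay nu d').
  by split => // d1 _; exact: rank_is_state.
split => //; first by rewrite !rank_is_state.
  by apply/rank_edgeP; exists l, a, g, l'.
by rewrite (@guard_holds_rank v (fun x => mu x + d)) //= => x; rewrite numu.
Qed.

Lemma rank_language v w :
  untimed_language R (inst v rank_pera) [seq enum_rank a | a <- w] <->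
  accepts v init (fun=> 0) w.
Proof.
split=> [[r [[_ rr] acc wr]]|acc].
  have := @run_accepts v init (fun=> 0) (@cv0 R _) r (fun=> erefl) rr acc.
  by rewrite wr -map_comp (eq_map (@enum_rankK _)) map_id.
have [r [rr lr wr]] := @accepts_run v init (fun=> 0) (@cv0 R _) w (fun=> erefl) acc.
by exists r; split => //; split => //; exact: rank_is_state.
Qed.

Lemma rank_preservation v :
  language_preservation R rank_pera v <->
  exists v', v' <> v /\ forall w, accepts v' init (fun=> 0) w <->
                                  accepts v init (fun=> 0) w.
Proof.
split=> -[v' [v'v H]]; exists v'; split => //.
  by move=> w; rewrite -!rank_language H.
apply/funext => w; apply/propext.
have -> : w = [seq enum_rank a | a <- [seq enum_val i | i <- w]].
  by rewrite -map_comp (eq_map (@enum_valK _)) map_id.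
by rewrite !rank_language.
Qed.

End TransitionFunction.

(** * The automaton of a register machine *)

(* [Tok j b] claims that instruction [j] is executed, with outcome [b] of the zero test; it
   opens the round [Tok j b, Aux1, Rec1, Aux2, Rec2]. *)
Inductive sym (N : nat) :=
  Start | Probe | Tick | Aux1 | Rec1 | Aux2 | Rec2 | Tok of 'I_N & bool.
Arguments Start {N}.
Arguments Probe {N}.
Arguments Tick {N}.
Arguments Aux1 {N}.
Arguments Rec1 {N}.
Arguments Aux2 {N}.
Arguments Rec2 {N}.

Definition sym_tag N (a : sym N) : 'I_7 :=
  match a with
  | Start => inord 0 | Probe => inord 1 | Tick => inord 2 | Aux1 => inord 3
  | Rec1 => inord 4 | Aux2 => inord 5 | _ => inord 6
  end.

Definition sym_code N (a : sym N) : 'I_7 + 'I_N * bool :=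
  if a is Tok j b then inr (j, b) else inl (sym_tag a).

Definition sym_decode N (c : 'I_7 + 'I_N * bool) : option (sym N) :=
  match c with
  | inl i => ohead (drop i [:: Start; Probe; Tick; Aux1; Rec1; Aux2; Rec2])
  | inr (j, b) => Some (Tok j b)
  end.

Lemma sym_codeK N : pcancel (@sym_code N) (@sym_decode N).
Proof. by case=> //=; rewrite inordK. Qed.

HB.instance Definition _ N := Finite.copy (sym N) (pcan_type (@sym_codeK N)).

(** A form of equality that reduces on constructors, unlike the one inherited through [inord]; it
    serves to evaluate clock resets. *)
Definition sym_eqb N (a b : sym N) : bool :=
  match a, b with
  | Start, Start | Probe, Probe | Tick, Tick | Aux1, Aux1 | Rec1, Rec1
  | Aux2, Aux2 | Rec2, Rec2 => true
  | Tok j b, Tok j' b' => (j == j') && (b == b')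
  | _, _ => false
  end.

Lemma sym_eqE N (a b : sym N) : (a == b) = sym_eqb a b.
Proof.
apply/eqP/idP => [<-|]; first by case: a => //= j c; rewrite !eqxx.
by case: a; case: b => //= j c j' c' /andP[/eqP-> /eqP->].
Qed.

Variant phase := PTok | PAux1 | PRec1 | PAux2 | PRec2.

Definition phase_code (h : phase) : 'I_5 :=
  match h with
  | PTok => inord 0 | PAux1 => inord 1 | PRec1 => inord 2 | PAux2 => inord 3
  | PRec2 => inord 4
  end.

Definition phase_decode (i : 'I_5) : option phase :=
  ohead (drop i [:: PTok; PAux1; PRec1; PAux2; PRec2]).

Lemma phase_codeK : pcancel phase_code phase_decode.
Proof. by case; rewrite /phase_decode inordK. Qed.

HB.instance Definition _ := Finite.copy phase (pcan_type phase_codeK).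

(* [IsPos] and [IsZero] preserve the register, and accept if it is positive, resp. zero: a
   run guesses them to expose a wrong branch.  [Preset] sets the register to its initial
   value. *)
Variant op := Preset | Keep | Incr | Decr | IsPos | IsZero.

Definition op_code (o : op) : 'I_6 :=
  match o with
  | Preset => inord 0 | Keep => inord 1 | Incr => inord 2 | Decr => inord 3
  | IsPos => inord 4 | IsZero => inord 5
  end.

Definition op_decode (i : 'I_6) : option op :=
  ohead (drop i [:: Preset; Keep; Incr; Decr; IsPos; IsZero]).

Lemma op_codeK : pcancel op_code op_decode.
Proof. by case; rewrite /op_decode inordK. Qed.

HB.instance Definition _ := Finite.copy op (pcan_type op_codeK).

(* [Timer] accepts short words, [Flow] follows the program counter, and [Cnt k] follows the
   register of instruction [k]. *)
Inductive loc (N : nat) :=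
  | Init | All | Pin | PinEnd | Timer
  | Flow of 'I_N & phase
  | Cnt of 'I_N & op & phase.
Arguments Init {N}.
Arguments All {N}.
Arguments Pin {N}.
Arguments PinEnd {N}.
Arguments Timer {N}.

Definition loc_code N (l : loc N) : 'I_5 + 'I_N * phase + 'I_N * op * phase :=
  match l with
  | Init => inl (inl (inord 0)) | All => inl (inl (inord 1))
  | Pin => inl (inl (inord 2)) | PinEnd => inl (inl (inord 3))
  | Timer => inl (inl (inord 4))
  | Flow j h => inl (inr (j, h))
  | Cnt k o h => inr (k, o, h)
  end.

Definition loc_decode N (c : 'I_5 + 'I_N * phase + 'I_N * op * phase) :
    option (loc N) :=
  match c with
  | inl (inl i) => ohead (drop i [:: Init; All; Pin; PinEnd; Timer])
  | inl (inr (j, h)) => Some (Flow j h)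
  | inr (k, o, h) => Some (Cnt k o h)
  end.

Lemma loc_codeK N : pcancel (@loc_code N) (@loc_decode N).
Proof. by case=> //=; rewrite inordK. Qed.

HB.instance Definition _ N := Finite.copy (loc N) (pcan_type (@loc_codeK N)).

Section Automaton.
Variable D : machine.
Local Notation N := (size D).
Local Notation bound := ('I_2 + int)%type.

Definition instr_at (j : nat) : instr := nth (Inc 0) D j.
Definition reg_of (i : instr) : nat := match i with Inc r | Dec r _ => r end.

Definition next_pc (j : nat) (b : bool) : nat :=
  match instr_at j with
  | Inc _ => j.+1
  | Dec _ k => if b then k else j.+1
  end.

Definition ops (r j : nat) (b : bool) : seq op :=
  if reg_of (instr_at j) != r then [:: Keep] else
  match instr_at j with
  | Inc _ => [:: Incr]
  | Dec _ _ => if b then [:: Keep; IsPos] else [:: Decr; IsZero]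
  end.

Definition pinit : bound := inl ord0.
Definition period : bound := inl ord_max.

Definition xeq (a : sym N) (b : bound) : guard (sym N) bound :=
  [:: (a, CmpLe, b); (a, CmpGe, b)].

(** Leaving the program means halting, after which every continuation is accepted. *)
Definition flow_at (pc : nat) (h : phase) : loc N :=
  if insub pc is Some j then Flow j h else All.

(** A symbol out of place sends the run to [All]; a well-formed word without halting keeps it in
    [Flow], which is not accepting. *)
Definition flow_step (j : 'I_N) (h : phase) (a : sym N) : loc N :=
  match h, a with
  | PTok, Tok j' b => if j' == j then flow_at (next_pc j b) PAux1 else All
  | PAux1, Aux1 => Flow j PRec1
  | PRec1, Rec1 => Flow j PAux2
  | PAux2, Aux2 => Flow j PRec2
  | PRec2, Rec2 => Flow j PTok
  | _, _ => All
  end.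

Definition load_bound (k : nat) : bound :=
  if reg_of (instr_at k) == 0%N then pinit else inr 0.

(** At the closing [Rec2], the clock of [Rec1] reads the new value of the register: [Preset] forces
    it to the initial value, [IsPos] and [IsZero] test it. *)
Definition last_guard (k : nat) (o : op) : guard (sym N) bound :=
  match o with
  | Preset => xeq Rec1 (load_bound k)
  | Incr => xeq Aux2 (inr 1)
  | IsPos => (Rec1, CmpGt, inr 0) :: xeq Rec2 period
  | IsZero => (Rec1, CmpLe, inr 0) :: xeq Rec2 period
  | _ => xeq Rec2 period
  end.

Definition after_round (k : 'I_N) (o : op) : loc N :=
  match o with IsPos | IsZero => All | _ => Cnt k Keep PTok end.

(** Guards are read before the reset, so [xeq Rec1 period] on the edge of [Rec1] makes this event
    recur with the period. Ill-formed words have no run here; [Flow] accepts them. *)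
Definition cnt_step (k : 'I_N) (o : op) (h : phase) (a : sym N) :
    seq (guard (sym N) bound * loc N) :=
  match h, a with
  | PTok, Tok j b => [seq ([::], Cnt k o' PAux1) | o' <- ops (reg_of (instr_at k)) j b]
  | PAux1, Aux1 =>
      [:: (if o is Decr then xeq Rec1 period else [::], Cnt k o PRec1)]
  | PRec1, Rec1 =>
      [:: (if o is Decr then xeq Aux1 (inr 1) else xeq Rec1 period, Cnt k o PAux2)]
  | PAux2, Aux2 =>
      [:: (if o is Incr then xeq Rec2 period else [::], Cnt k o PRec2)]
  | PRec2, Rec2 =>
      [:: (last_guard k o, after_round k o)]
  | _, _ => [::]
  end.

(** The first symbol comes at time 0, so the edge to [All] requires a zero period. [Timer] wants
    [Rec2] events at least one unit apart and within one period of [Start]; it refuses a second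
    [Start], which would reset that clock. [Pin] compares the number of unit ticks with [pinit]. *)
Definition step (l : loc N) (a : sym N) : seq (guard (sym N) bound * loc N) :=
  match l, a with
  | Init, Start =>
      let z := (Start, CmpLe, inr 0) in
      [:: ([:: z; (Start, CmpGe, period)], All), ([:: z], Timer),
          ([:: z], flow_at 0 PRec2) &
          [seq ([:: z], Cnt k Preset PRec2) | k <- enum 'I_N]]
  | Init, Probe => [:: ([:: (Probe, CmpLe, inr 0)], Pin)]
  | Pin, Tick => [:: (xeq Tick (inr 1), Pin)]
  | Pin, Probe => [:: ((Tick, CmpLe, inr 0) :: xeq Probe pinit, PinEnd)]
  | Timer, Start => [::]
  | Timer, Rec2 =>
      [:: ([:: (Rec2, CmpGe, inr 1); (Start, CmpLe, period)], Timer)]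
  | Timer, _ => [:: ([::], Timer)]
  | All, _ => [:: ([::], All)]
  | Flow j h, _ => [:: ([::], flow_step j h a)]
  | Cnt k o h, _ => cnt_step k o h a
  | _, _ => [::]
  end.

Definition accepting : {set loc N} :=
  [set l | if l is (All | Timer | PinEnd) then true else false].


(** * Timing analysis of the locations *)

Variables (R : realType) (v : param_valuation 'I_2).
Local Notation x0 := (ratr (v ord0)%:num : R).
Local Notation p := (ratr (v ord_max)%:num : R).
Local Notation acc := (accepts (R := R) step accepting v).

Lemma accepting_All w (mu : sym N -> R) : acc All mu w.
Proof.
elim: w mu => [|a w IH] mu /=; first by rewrite inE.
by exists 0, [::], All; rewrite mem_head.
Qed.

Lemma accepts_step1 l a g l' w (mu : sym N -> R) : step l a = [:: (g, l')] ->
  acc l mu (a :: w) <->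
  exists d, [/\ 0 <= d, guard_holds v (fun x => mu x + d) g &
    acc l' (fun x => if x == a then 0 else mu x + d) w].
Proof.
move=> /= ->; split=> [[d [g' [l'' []]]]|[d [d0 gd acd]]].
  by rewrite inE => d0 /eqP[-> ->]; exists d.
by exists d, g, l'; rewrite mem_head.
Qed.

Lemma accepts_step1_inv l a w (mu : sym N -> R) : acc l mu (a :: w) ->
  forall g l', step l a = [:: (g, l')] ->
  exists d, [/\ 0 <= d, guard_holds v (fun x => mu x + d) g &
    acc l' (fun x => if x == a then 0 else mu x + d) w].
Proof. by move=> H g l' /accepts_step1 <-. Qed.

Lemma accepts_free l a l' w : step l a = [:: ([::], l')] ->
  (forall mu : sym N -> R, acc l' mu w) -> forall mu : sym N -> R, acc l mu (a :: w).
Proof. by move=> st H mu; apply/(accepts_step1 _ _ st); exists 0. Qed.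

Lemma guard_xeq (mu : sym N -> R) a b :
  guard_holds v mu (xeq a b) = (mu a == ratr (inst_bound v b)).
Proof. by rewrite /= andbT eq_le. Qed.

(* The delays of a round, [x] and [y] being the values of the clocks of [Rec1] and [Rec2] at
   its start.  Delaying by 1, through [Aux2] or [Aux1], the recurrence of [Rec2] or [Rec1]
   increments or decrements the register. *)
Definition round_timing (k : nat) (o : op) (x y d1 d2 d3 d4 : R) : Prop :=
  let keep := x + d1 + d2 = p /\ y + d1 + d2 + d3 + d4 = p in
  match o with
  | Preset => x + d1 + d2 = p /\ d3 + d4 = ratr (inst_bound v (load_bound k))
  | Keep => keep
  | Incr => x + d1 + d2 = p /\ y + d1 + d2 + d3 = p /\ d4 = 1
  | Decr => x + d1 = p /\ d2 = 1 /\ y + d1 + d2 + d3 + d4 = p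
  | IsPos => keep /\ 0 < d3 + d4
  | IsZero => keep /\ d3 + d4 <= 0
  end.

(** [Rec1] is reset before the last two delays, so its clock ends at [d3 + d4], the new value of the
    register. *)
Lemma round_run k o (mu : sym N -> R) w :
  acc (Cnt k o PAux1) mu [:: Aux1, Rec1, Aux2, Rec2 & w] ->
  exists d1 d2 d3 d4 mu', [/\ [/\ 0 <= d1, 0 <= d2, 0 <= d3 & 0 <= d4],
    round_timing k o (mu Rec1) (mu Rec2) d1 d2 d3 d4, mu' Rec1 = d3 + d4, mu' Rec2 = 0 &
    acc (after_round k o) mu' w].
Proof.
move=> /accepts_step1_inv/(_ _ _ erefl)[d1 [d1_ge0 g1]].
move=> /accepts_step1_inv/(_ _ _ erefl)[d2 [d2_ge0 g2]].
move=> /accepts_step1_inv/(_ _ _ erefl)[d3 [d3_ge0 g3]].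
move=> /accepts_step1_inv/(_ _ _ erefl)[d4 [d4_ge0 g4 H]].
eexists d1, d2, d3, d4, _; split; last exact: H.
- by [].
- by case: o g1 g2 g3 g4 {H}; rewrite ?guard_xeq /= ?sym_eqE /= ?ratr_int
    ?andbT -?eq_le => *; repeat split; lra.
- by rewrite /= !sym_eqE /= add0r.
- by rewrite /= !sym_eqE.
Qed.

Lemma round_accepts (k : 'I_N) o (mu : sym N -> R) (w : seq (sym N)) d1 d2 d3 d4 :
  0 <= d1 -> 0 <= d2 -> 0 <= d3 -> 0 <= d4 ->
  round_timing k o (mu Rec1) (mu Rec2) d1 d2 d3 d4 ->
  (forall mu' : sym N -> R, mu' Rec1 = d3 + d4 -> mu' Rec2 = 0 ->
    acc (after_round k o) mu' w) ->
  acc (Cnt k o PAux1) mu [:: Aux1, Rec1, Aux2, Rec2 & w].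
Proof.
move=> d1_ge0 d2_ge0 d3_ge0 d4_ge0 rt H.
apply/(@accepts_step1 (Cnt k o PAux1) Aux1 _ _ _ _ erefl); exists d1; split=> //.
  by case: o rt {H} => //; rewrite guard_xeq /= => *; lra.
apply/(@accepts_step1 (Cnt k o PRec1) Rec1 _ _ _ _ erefl); exists d2; split=> //.
  by case: o rt {H} => //; rewrite guard_xeq /= !sym_eqE /= ?ratr_int => *; lra.
apply/(@accepts_step1 (Cnt k o PAux2) Aux2 _ _ _ _ erefl); exists d3; split=> //.
  by case: o rt {H} => //; rewrite guard_xeq /= !sym_eqE /= ?ratr_int => *; lra.
apply/(@accepts_step1 (Cnt k o PRec2) Rec2 _ _ _ _ erefl); exists d4; split=> //.
  by case: o rt {H}; rewrite /= ?guard_xeq /= ?sym_eqE /= ?ratr_int -?eq_le ?andbT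
    => *; lra.
by apply: H; rewrite /= !sym_eqE /= ?add0r.
Qed.

(** The run waits one unit before each [Rec2] and not at all before other symbols. *)
Lemma accepts_Timer w (mu : sym N -> R) : Start \notin w -> 0 <= mu Rec2 ->
  mu Start + (count_mem Rec2 w)%:R <= p -> acc Timer mu w.
Proof.
elim: w mu => [|a w IH] mu; first by rewrite /= inE.
rewrite inE negb_or eq_sym !sym_eqE => /andP[nS nSw] mu0 /=.
rewrite sym_eqE natrD addrA => le_p.
have [aR|naR] := boolP (sym_eqb a Rec2); last first.
  have st : step Timer a = [:: ([::], Timer)] by case: a nS naR {le_p}.
  apply/(accepts_step1 _ _ st); exists 0; split=> //.
  by apply: IH => //; rewrite sym_eqE; case: a nS naR le_p {st} => //=; rewrite !addr0.
case: a nS aR le_p => //= _ _ le_p.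
apply/(@accepts_step1 Timer Rec2 _ _ _ _ erefl); exists 1; split=> //.
  have : 0 <= (count_mem Rec2 w)%:R :> R by rewrite ler0n.
  by rewrite /= ratr_int; lra.
by apply: IH => //; rewrite !sym_eqE //=; lra.
Qed.

(** The difference [mu Start - mu Rec2] is unchanged by delays and other symbols, and grows by at
    least 1 at each [Rec2]; the last [Rec2] comes within the period. *)
Lemma Timer_bound w (mu : sym N -> R) : acc Timer mu w -> Rec2 \in w ->
  mu Start - mu Rec2 + (count_mem Rec2 w)%:R <= p.
Proof.
elim: w mu => [|a w IH] mu // acc_aw.
have /orP[aR|naR] := orbN (sym_eqb a Rec2).
  case: a aR acc_aw => // _ /accepts_step1_inv/(_ _ _ erefl)[d [d0 g /IH H]] _.
  move: g H; rewrite /= !sym_eqE /= ratr_int natrD.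
  case: (boolP (Rec2 \in w)) => [_ g /(_ isT) | ]; first by lra.
  by move=> /count_memPn -> g _; lra.
case: a naR acc_aw => [||||||| i b] // _; first by case=> [? [? [? []]]].
all: move=> /accepts_step1_inv/(_ _ _ erefl)[d [d0 _ /IH H]].
all: by rewrite inE !sym_eqE /= => /H; rewrite !sym_eqE /=; lra.
Qed.

(** Ticks are one unit apart and the closing [Probe] comes without delay, so the clock of [Probe]
    gains exactly the number of ticks. *)
Lemma accepts_Pin w (mu : sym N -> R) : mu Tick = 0 ->
  acc Pin mu w <-> exists m, w = rcons (nseq m Tick) Probe /\ mu Probe + m%:R = x0.
Proof.
elim: w mu => [|a w IH] mu mu0.
  split; first by rewrite /= inE.
  by move=> [[|m] []].
case: a => [||||||| i b]; try by split=> [[? [? [? []]]] | [[|m] []]].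
- rewrite (@accepts_step1 Pin Probe _ _ _ _ erefl); split=> [[d [d0 g]]|].
    case: w {IH} => [_|b w [? [? [? []]]] //]; exists 0; split=> //.
    by move: g; rewrite /= !ratr_int mu0; lra.
  move=> [[|m] [] //= [->] x0E]; exists 0; split => //; last by rewrite /= inE.
  by rewrite /= !ratr_int mu0; lra.
rewrite (@accepts_step1 Pin Tick _ _ _ _ erefl); split=> [[d [d0 g]]|].
  move=> /IH; rewrite /= !sym_eqE /= => /(_ erefl)[m [-> mE]].
  exists m.+1; split=> //.
  by move: g mE; rewrite /= !ratr_int mu0 -natr1; lra.
move=> [[|m] [] //= [wE]]; rewrite -natr1 => x0E; exists 1; split=> //.
  by rewrite /= !ratr_int mu0; lra.
rewrite IH /= !sym_eqE //=; exists m; rewrite -?wE; split=> //; lra.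
Qed.

(** * Honest computations are rejected, the other words are accepted *)

Implicit Types (c : machine_config) (mu : sym N -> R) (u : seq (sym N)) (k j : 'I_N).

(** Despite its name, the correct outcome of the zero test. *)
Definition guess c : bool := c.2 (reg_of (instr_at c.1)) == 0%N.

Lemma next_pc_step c :
  ~~ halted D c -> next_pc c.1 (guess c) = (machine_step D c).1.
Proof.
rewrite /next_pc /machine_step /guess => /negbTE->; rewrite -/(instr_at c.1).
by case: (instr_at c.1) => [r|r k] //=; case: ifP.
Qed.

(** Under the correct outcome, updates agree with the machine, while [IsPos] can only meet a zero
    register and [IsZero] a positive one. Decrement is phrased with a successor to avoid truncated
    subtraction. *)
Lemma op_step c o r : ~~ halted D c -> o \in ops r c.1 (guess c) ->
  match o with
  | Preset => False
  | Keep => (machine_step D c).2 r = c.2 r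
  | Incr => (machine_step D c).2 r = (c.2 r).+1
  | Decr => c.2 r = ((machine_step D c).2 r).+1
  | IsPos => c.2 r = 0%N
  | IsZero => (0 < c.2 r)%N
  end.
Proof.
rewrite /ops /machine_step /guess => /negbTE->; rewrite -/(instr_at c.1).
have set_neq (f : nat -> nat) s n : s != r -> set_reg f s n r = f r.
  by rewrite /set_reg eq_sym => /negbTE->.
have set_eq (f : nat -> nat) s n : set_reg f s n s = n by rewrite /set_reg eqxx.
case: ifP => [rne|/negbFE/eqP <-].
  rewrite inE => /eqP->; case: (instr_at c.1) rne => [s|s k] /= sr.
    exact: set_neq.
  by case: ifP => //= _; exact: set_neq.
case: (instr_at c.1) => [s|s k] /=.
  by rewrite inE => /eqP-> /=; rewrite set_eq.
case: ifP => [/eqP c0|c_neq0]; rewrite !inE => /orP[] /eqP-> //=.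
- by rewrite set_eq prednK // lt0n c_neq0.
- by rewrite lt0n c_neq0.
Qed.

Lemma exists_op c r :
  exists2 o, o \in ops r c.1 (guess c) & (o = Keep \/ o = Incr \/ o = Decr).
Proof.
rewrite /ops; case: ifP => _.
  by exists Keep; [exact: mem_head | left].
case: (instr_at c.1) => [s|s k].
  by exists Incr; [exact: mem_head | right; left].
case: (guess c); first by exists Keep; [exact: mem_head | left].
by exists Decr; [exact: mem_head | right; right].
Qed.

(** At an increment both outcomes have the same effect; at a zero test, a false claim is exposed by
    the tested register itself. *)
Lemma wrong_guess c b :
  [\/ next_pc c.1 b = next_pc c.1 (guess c) /\
      (forall r, ops r c.1 b = ops r c.1 (guess c)),
      IsPos \in ops (reg_of (instr_at c.1)) c.1 b /\
        (0 < c.2 (reg_of (instr_at c.1)))%N |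
      IsZero \in ops (reg_of (instr_at c.1)) c.1 b /\
        c.2 (reg_of (instr_at c.1)) = 0%N].
Proof.
rewrite /guess /next_pc /ops eqxx /=.
case: (instr_at c.1) => [s|s k] /=; first by constructor 1.
have [c0|c_neq0] := eqVneq (c.2 s) 0%N; case: b; try by constructor 1.
  by constructor 3; rewrite !inE eqxx orbT.
by constructor 2; rewrite !inE eqxx orbT lt0n.
Qed.

(** The honest computation, with the correct outcome in each round. *)
Fixpoint trace (m : nat) c : seq (sym N) :=
  if m is m'.+1 then
    if insub c.1 is Some j then
      [:: Tok j (guess c), Aux1, Rec1, Aux2, Rec2 & trace m' (machine_step D c)]
    else [::]
  else [::].

Lemma insub_pc c : ~~ halted D c -> exists2 j : 'I_N, insub c.1 = Some j & j = c.1 :> nat.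
Proof.
rewrite /halted -ltnNge => cN; exists (Ordinal cN) => //.
by rewrite insubT.
Qed.

Lemma trace_step c : ~~ halted D c -> exists2 j : 'I_N, val j = c.1 & forall m,
  trace m.+1 c =
    [:: Tok j (guess c), Aux1, Rec1, Aux2, Rec2 & trace m (machine_step D c)].
Proof. by move=> /insub_pc[j jE jc]; exists j => // m /=; rewrite jE. Qed.

(** An honest diverging trace is well-formed and never leaves the program, so [Flow] never reaches
    [All]. *)
Lemma Flow_trace m c j mu :
  (forall t, ~~ halted D (iter t (machine_step D) c)) -> j = c.1 :> nat ->
  ~ acc (Flow j PTok) mu (trace m c).
Proof.
elim: m c j mu => [|m IH] c j mu run jc; first by rewrite /= inE.
have [j' j'c ->] := trace_step (run 0%N); rewrite /= in j'c.
have <- : j = j' by apply: val_inj; rewrite /= jc.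
have run' t : ~~ halted D (iter t (machine_step D) (machine_step D c)).
  by rewrite -iterSr; exact: run.
have [k kE kc] := insub_pc (run' 0%N); rewrite /= in kE kc.
move=> /accepts_step1_inv/(_ _ _ erefl)[? [_ _]].
have -> : flow_step j PTok (Tok j (guess c)) = Flow k PAux1.
  by rewrite /= eqxx /flow_at jc (next_pc_step (run 0%N)) kE.
do 4! move=> /accepts_step1_inv/(_ _ _ erefl)[? [_ _]].
exact: IH.
Qed.

(** Here [d] is the time elapsed since the last [Rec2]: the clocks of [Rec1] and [Rec2] differ by
    the register, and the timing carries this difference over, shifted by 1 for an update. By
    [op_step], the tests [IsPos] and [IsZero] contradict it. *)
Lemma round_value c o k (d1 d2 d3 d4 : R) : ~~ halted D c ->
  0 <= d3 -> 0 <= d4 ->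
  o \in ops (reg_of (instr_at k)) c.1 (guess c) ->
  forall d, round_timing k o ((c.2 (reg_of (instr_at k)))%:R + d) d d1 d2 d3 d4 ->
  after_round k o = Cnt k Keep PTok /\
  d3 + d4 = ((machine_step D c).2 (reg_of (instr_at k)))%:R.
Proof.
move=> run d3_ge0 d4_ge0 /(op_step run).
case: o => //= [->|->|->|->|] => [||||c0] d; rewrite -?natr1.
- by move=> *; split=> //; lra.
- by move=> *; split=> //; lra.
- by move=> *; split=> //; lra.
- by move=> *; lra.
have : 0 < (c.2 (reg_of (instr_at k)))%:R :> R by rewrite ltr0n.
by move=> *; lra.
Qed.

Lemma Cnt_trace m c k mu :
  (forall t, ~~ halted D (iter t (machine_step D) c)) ->
  mu Rec1 = (c.2 (reg_of (instr_at k)))%:R -> mu Rec2 = 0 ->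
  ~ acc (Cnt k Keep PTok) mu (trace m c).
Proof.
elim: m c mu => [|m IH] c mu run mu1 mu2; first by rewrite /= inE.
have [j jc ->] := trace_step (run 0%N); rewrite /= in jc.
have run' t : ~~ halted D (iter t (machine_step D) (machine_step D c)).
  by rewrite -iterSr; exact: run.
move=> [d [g [l' [_ /mapP[o]]]]]; rewrite jc => oP [-> ->] _.
move=> /round_run[d1 [d2 [d3 [d4 [mu' [[_ _ d3_ge0 d4_ge0]]]]]]].
rewrite !sym_eqE /= mu1 mu2 add0r.
move=> /(round_value (run 0%N) d3_ge0 d4_ge0 oP)[-> ->] mu'1 mu'2.
exact: IH.
Qed.

(** A word that does not begin with a full round either breaks the format, and [Flow] accepts it, or
    is a proper prefix of a round, harmless for [Timer]. *)
Lemma incomplete_round j u :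
  [\/ forall mu, acc (Flow j PAux1) mu u,
      exists w, u = [:: Aux1, Rec1, Aux2, Rec2 & w] |
      Start \notin u /\ count_mem Rec2 u = 0%N].
Proof.
case: u => [|a u]; first by constructor 3.
case: a => [||||||| i b];
  try by constructor 1; eapply accepts_free; [reflexivity|]; exact: accepting_All.
case: u => [|a u]; first by constructor 3; rewrite /= !inE !sym_eqE.
case: a => [||||||| i b];
  try by constructor 1; do 2 (eapply accepts_free; [reflexivity|]);
  exact: accepting_All.
case: u => [|a u]; first by constructor 3; rewrite /= !inE !sym_eqE.
case: a => [||||||| i b];
  try by constructor 1; do 3 (eapply accepts_free; [reflexivity|]);
  exact: accepting_All.
case: u => [|a u]; first by constructor 3; rewrite /= !inE !sym_eqE.
case: a => [||||||| i b];
  try by constructor 1; do 4 (eapply accepts_free; [reflexivity|]);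
  exact: accepting_All.
by constructor 2; exists u.
Qed.

Lemma wrong_guess_accepted k o c mu w : o = IsPos /\ (0 < c.2 (reg_of (instr_at k)))%N \/
    o = IsZero /\ c.2 (reg_of (instr_at k)) = 0%N ->
  (c.2 (reg_of (instr_at k)))%:R <= p ->
  mu Rec1 = (c.2 (reg_of (instr_at k)))%:R -> mu Rec2 = 0 ->
  acc (Cnt k o PAux1) mu [:: Aux1, Rec1, Aux2, Rec2 & w].
Proof.
set r := reg_of _; move=> oE le_p mu1 mu2.
have r0 : 0 <= (c.2 r)%:R :> R by rewrite ler0n.
(* [Rec1] comes when its clock reaches the period; [Rec2] follows after the value of the register,
   when its own clock does. *)
apply: (@round_accepts _ _ _ _ (p - (c.2 r)%:R) 0 (c.2 r)%:R 0) => //.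
- lra.
- rewrite mu1 mu2; case: oE => -[-> c0] /=.
    have : 0 < (c.2 r)%:R :> R by rewrite ltr0n.
    by lra.
  by rewrite c0; lra.
- move=> mu' _ _; case: oE => -[-> _]; exact: accepting_All.
Qed.

Lemma right_guess_accepted k o c mu w : ~~ halted D c ->
  o \in ops (reg_of (instr_at k)) c.1 (guess c) -> (o = Keep \/ o = Incr \/ o = Decr) ->
  (c.2 (reg_of (instr_at k)))%:R <= p ->
  mu Rec1 = (c.2 (reg_of (instr_at k)))%:R -> mu Rec2 = 0 ->
  (forall mu', mu' Rec1 = ((machine_step D c).2 (reg_of (instr_at k)))%:R ->
    mu' Rec2 = 0 -> acc (Cnt k Keep PTok) mu' w) ->
  acc (Cnt k o PAux1) mu [:: Aux1, Rec1, Aux2, Rec2 & w].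
Proof.
set r := reg_of _; move=> run oP oE le_p mu1 mu2 H.
have r0 : 0 <= (c.2 r)%:R :> R by rewrite ler0n.
have := op_step run oP; case: oE => [|[]] oE; rewrite oE => cE.
- apply: (@round_accepts _ _ _ _ (p - (c.2 r)%:R) 0 (c.2 r)%:R 0) => //.
  + lra.
  + by rewrite mu1 mu2 /=; lra.
  by move=> mu' mu'1 mu'2; apply: H => //; rewrite mu'1 cE addr0.
- apply: (@round_accepts _ _ _ _ (p - (c.2 r)%:R) 0 (c.2 r)%:R 1) => //.
  + lra.
  + by rewrite mu1 mu2 /=; lra.
  by move=> mu' mu'1 mu'2; apply: H => //; rewrite mu'1 cE natr1.
- have c'0 : 0 <= ((machine_step D c).2 r)%:R :> R by rewrite ler0n.
  move: r0 le_p mu1; rewrite cE -natr1 => r0 le_p mu1.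
  (* [Aux1] takes the date at which [Rec1] is due, and [Rec1] comes one unit late, hence one unit
     closer to [Rec2]. *)
  apply: (@round_accepts _ _ _ _ (p - ((machine_step D c).2 r).+1%:R) 1
            ((machine_step D c).2 r)%:R 0) => //; rewrite -?natr1.
  + lra.
  + by rewrite mu1 mu2 /=; lra.
  by move=> mu' mu'1 mu'2; apply: H => //; rewrite mu'1 addr0.
Qed.

Lemma Cnt_Tok k o j b mu w : o \in ops (reg_of (instr_at k)) j b ->
  acc (Cnt k o PAux1) (fun x => if x == Tok j b then 0 else mu x) w ->
  acc (Cnt k Keep PTok) mu (Tok j b :: w).
Proof.
move=> oP H; exists 0, [::], (Cnt k o PAux1); split=> //.
  exact/mapP/(ex_intro2 _ _ o).
suff -> : (fun x => if x == Tok j b then 0 else mu x + 0) =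
          (fun x => if x == Tok j b then 0 else mu x) by [].
by apply/funext => x; rewrite addr0.
Qed.

(** Induction on the halting time: each correct round uses up one step, and anything else is
    accepted by [Flow], [Cnt] or [Timer]. The register [k] is chosen before the clocks because a run
    selects it at [Start]. *)
Lemma halting_accepted t c j u : j = c.1 :> nat -> halted D (iter t (machine_step D) c) ->
  (forall k, (c.2 (reg_of (instr_at k)))%:R + t%:R <= p) ->
  [\/ forall mu, acc (Flow j PTok) mu u,
      exists k, forall mu, mu Rec1 = (c.2 (reg_of (instr_at k)))%:R -> mu Rec2 = 0 ->
        acc (Cnt k Keep PTok) mu u |
      Start \notin u /\ (count_mem Rec2 u <= t)%N].
Proof.
elim: t c j u => [|t IH] c j u jc; first by rewrite /= /halted -jc leqNgt ltn_ord.
rewrite iterSr => run' le_p.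
have run : ~~ halted D c by rewrite /halted -jc -ltnNge ltn_ord.
have le_p' k : (c.2 (reg_of (instr_at k)))%:R <= p.
  by have := le_p k; have : 0 <= t.+1%:R :> R := ler0n _ _; lra.
case: u => [|a u]; first by constructor 3.
case: a => [||||||| i b];
  try by constructor 1; eapply accepts_free; [reflexivity|]; exact: accepting_All.
have [->|ij] := eqVneq i j; last first.
  constructor 1; apply: accepts_free (accepting_All u) => /=.
  by rewrite (negbTE ij).
case nextE: (insub (next_pc c.1 b) : option 'I_N) => [j'|]; last first.
  by constructor 1; apply: accepts_free (accepting_All u); rewrite /= eqxx /flow_at jc nextE.
have flowE : step (Flow j PTok) (Tok j b) = [:: ([::], Flow j' PAux1)].
  by rewrite /= eqxx /flow_at jc nextE.
have [H|[w ->]|[Su Ru]] := incomplete_round j' u.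
- by constructor 1; apply: accepts_free flowE H.
- have [[pcE opsE]|[oP c0]|[oP c0]] := wrong_guess c b.
  + move: nextE; rewrite pcE next_pc_step // => nextE.
    have j'c : j' = (machine_step D c).1 :> nat.
      by move: nextE; case: insubP => // ? _ <- [->].
    have [|H|[k H]|[Sw Rw]] := IH _ _ w j'c run'.
    (* A step raises a register by at most one, which the decrease of [t.+1] to [t] compensates. *)
    * move=> k; have [o oP oE] := exists_op c (reg_of (instr_at k)).
      have := le_p k; have := op_step run oP.
      by case: oE => [|[]] ->; [move=> -> | move=> -> | move=> ->]; rewrite -?natr1; lra.
    * constructor 1; apply: (accepts_free flowE).
      by do 4 (eapply accepts_free; [reflexivity|]).
    * constructor 2; exists k => mu mu1 mu2.
      have [o oP oE] := exists_op c (reg_of (instr_at k)).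
      apply: (@Cnt_Tok k o); first by rewrite jc opsE.
      by apply: right_guess_accepted run oP oE _ _ _ H; rewrite ?sym_eqE.
    * constructor 3; rewrite /= !inE !sym_eqE /=; split => //.
  (* The exposing run follows the register that instruction [j] tests. *)
  + constructor 2; exists j => mu mu1 mu2.
    apply: (@Cnt_Tok j IsPos); first by rewrite jc.
    apply: (@wrong_guess_accepted _ _ c); rewrite ?sym_eqE // jc.
    by left.
  constructor 2; exists j => mu mu1 mu2.
  apply: (@Cnt_Tok j IsZero); first by rewrite jc.
  apply: (@wrong_guess_accepted _ _ c); rewrite ?sym_eqE // jc.
  by right.
by constructor 3; rewrite /= inE !sym_eqE /= Ru.
Qed.

End Automaton.

(** * The language of the automaton and its preservation *)

Section Language.
Variable D : machine.
Local Notation N := (size D).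
Variables (R : realType).
Local Notation acc v := (accepts (R := R) (@step D) (accepting D) v).
Implicit Types (v : param_valuation 'I_2) (u : seq (sym N)) (n : nat).

(** The guard [z], common to all edges from [Init] under [Start], leaves no room for a delay. *)
Lemma accepts_Init_Start v u :
  acc v Init (fun=> 0) (Start :: u) <->
  exists g l', [/\ (g, l') \in step (Init : loc N) Start, guard_holds v (fun=> 0 : R) g &
                   acc v l' (fun=> 0) u].
Proof.
have E (d : R) : d = 0 ->
    (fun=> 0 + d) = (fun=> 0 : R) :> (sym N -> R) /\
    (fun x => if x == Start then 0 else 0 + d) = (fun=> 0 : R) :> (sym N -> R).
  by move=> ->; split; apply/funext => x; rewrite addr0 ?if_same.
split=> [[d [g [l' [d_ge0 gl gd]]]]|[g [l' [gl gd H]]]]; last first.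
  by exists 0, g, l'; have [-> ->] := E 0 erefl.
have d0 : d = 0.
  move: gl gd; rewrite !inE => /or4P[/eqP|/eqP|/eqP|/mapP[k _]] [-> _] /=;
    by rewrite ratr_int; lra.
by have [gE HE] := E d d0; cbv beta in gd; rewrite gE HE in gd *; exists g, l'.
Qed.

Lemma accepts_Init_Probe v w :
  acc v Init (fun=> 0) (Probe :: w) <->
  exists m, w = rcons (nseq m Tick) Probe /\ m%:R = ratr (v ord0)%:num :> R.
Proof.
rewrite (@accepts_step1 _ _ _ Init Probe _ _ _ _ erefl); split.
  move=> [d [d0 g]].
  have {g d0} -> : d = 0 by move: g; rewrite /= ratr_int; lra.
  move=> /accepts_Pin; rewrite /= !sym_eqE add0r => /(_ erefl)[m [-> mE]].
  by exists m; rewrite add0r in mE.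
move=> [m [-> mE]]; exists 0; split => //; first by rewrite /= ratr_int; lra.
by apply/accepts_Pin; [rewrite sym_eqE addr0 | exists m; rewrite sym_eqE add0r].
Qed.

Lemma accepts_Init v w :
  acc v Init (fun=> 0) w -> exists u, w = Start :: u \/ w = Probe :: u.
Proof.
case: w => [|a w]; first by rewrite /= inE.
by case: a => [||||||| i b] H; try (by case: H => [? [? [? []]]]);
  exists w; [left | right].
Qed.

Lemma Start_period0 v u : (v ord_max)%:num = 0 -> acc v Init (fun=> 0) (Start :: u).
Proof.
move=> p0; apply/accepts_Init_Start.
exists [:: (Start, CmpLe, inr 0); (Start, CmpGe, period)], All; split=> //.
- by rewrite !inE eqxx.
- by rewrite /= p0 !rmorph0 lexx.
- exact: accepting_All.
Qed.

(** Registers start at most at [n] and gain at most [t]; [Timer] has to read up to [t] rounds and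
    the opening [Rec2]. The period [(n + t).+1] covers both. *)
Lemma Start_halting v n t u : (v ord0)%:num = n%:R ->
  halted D (iter t (machine_step D) (machine_input n)) ->
  (n + t).+1%:R <= ratr (v ord_max)%:num :> R ->
  acc v Init (fun=> 0) (Start :: u).
Proof.
move=> x0E halt le_p; apply/accepts_Init_Start.
have z : guard_holds v (fun=> 0 : R) [:: (Start : sym N, CmpLe, inr 0)].
  by rewrite /= ratr_int lexx.
have timer u' : Start \notin u' -> (count_mem Rec2 u' <= t.+1)%N ->
    acc v Timer (fun=> 0) u'.
  move=> Su Ru; apply: accepts_Timer => //; rewrite add0r (le_trans _ le_p) //.
  by rewrite ler_nat; lia.
have flow : (forall mu : sym N -> R, acc v (flow_at D 0 PRec2) mu u) ->
   exists g l', [/\ (g, l') \in step (Init : loc N) Start, guard_holds v (fun=> 0 : R) g &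
                   acc v l' (fun=> 0) u].
  move=> H; exists [:: (Start, CmpLe, inr 0)], (flow_at D 0 PRec2); split=> //.
  by rewrite !inE eqxx !orbT.
case jE : (insub 0%N : option 'I_N) => [j|]; last first.
  by apply: flow => mu; rewrite /flow_at jE; exact: accepting_All.
have flE : flow_at D 0 PRec2 = Flow j PRec2 by rewrite /flow_at jE.
have tim : Start \notin u -> (count_mem Rec2 u <= t.+1)%N -> exists g l',
   [/\ (g, l') \in step (Init : loc N) Start, guard_holds v (fun=> 0 : R) g &
                   acc v l' (fun=> 0) u].
  move=> Su Ru; exists [:: (Start, CmpLe, inr 0)], Timer; split=> //; last exact: timer.
  by rewrite !inE eqxx !orbT.
case: u flow tim => [|a u] flow tim; first exact: tim.
case: a flow tim => [||||||| i b] flow tim;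
  try by apply: flow; rewrite flE; eapply accepts_free; [reflexivity|];
  exact: accepting_All.
have jc : j = (machine_input n).1 :> nat by move: jE; case: insubP => // ? _ /= <- [->].
have [|H|[k H]|[Su Ru]] := @halting_accepted D R v t _ _ u jc halt.
- move=> k; apply: le_trans le_p; rewrite -natrD ler_nat /= /set_reg.
  by case: ifP => _; lia.
- by apply: flow; rewrite flE; apply: accepts_free H.
- exists [:: (Start, CmpLe, inr 0)], (Cnt k Preset PRec2); split=> //.
    rewrite !inE; apply/or4P; constructor 4.
    by apply/mapP; exists k; rewrite ?mem_enum.
  apply/(@accepts_step1 _ _ _ (Cnt k Preset PRec2) Rec2 _ _ _ _ erefl).
  (* Waiting for the initial value before the opening [Rec2] leaves it on the clock of [Rec1]. *)
  exists (ratr (inst_bound v (load_bound D k))).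
  have bE : ratr (inst_bound v (load_bound D k)) =
            ((machine_input n).2 (reg_of (instr_at D k)))%:R :> R.
    rewrite /load_bound /= /set_reg; case: ifP => _ /=.
      by rewrite x0E ratr_nat.
    by rewrite ratr_int.
  rewrite bE; split => //; first by rewrite /last_guard guard_xeq bE add0r.
  by apply: H; rewrite /= !sym_eqE //= add0r.
- apply: tim; first by rewrite inE sym_eqE.
  by rewrite /= sym_eqE.
Qed.

Lemma count_trace m c : (forall t, ~~ halted D (iter t (machine_step D) c)) ->
  count_mem (Rec2 : sym N) (trace D m c) = m.
Proof.
elim: m c => [|m IH] c run //.
have [j _ ->] := trace_step (run 0%N).
rewrite /= !sym_eqE /= IH // => t; rewrite -iterSr; exact: run.
Qed.

(** An honest trace with more rounds than the period defeats every edge under [Start]: [All] by the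
    nonzero period, [Timer] by length, [Flow] and [Cnt] by honesty. *)
Lemma Start_diverging v n : (v ord0)%:num = n%:R -> (v ord_max)%:num <> 0 ->
  (forall t, ~~ halted D (iter t (machine_step D) (machine_input n))) ->
  exists u, ~ acc v Init (fun=> 0) (Start :: u).
Proof.
move=> x0E p_neq0 run.
set p : R := ratr (v ord_max)%:num.
have p_gt0 : 0 < p.
  by rewrite ltr0q lt0r; apply/andP; split; [exact/eqP|].
pose m := Num.bound p; exists (Rec2 :: trace D m (machine_input n)).
move=> /accepts_Init_Start[g [l']]; rewrite !inE.
move=> -[/or4P[/eqP|/eqP|/eqP|/mapP[k _]]] [-> ->] gd.
- by move: gd p_gt0; rewrite /= -/p; lra.
- move=> /Timer_bound; rewrite mem_head => /(_ isT).
  rewrite -cat1s count_cat count_trace // [count_mem _ _]/= sym_eqE /= !natrD -/p.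
  have := archi_boundP (ltW p_gt0); rewrite -/m.
  by lra.
- have [j jE jc] := insub_pc (run 0%N).
  rewrite /flow_at jE => /accepts_step1_inv/(_ _ _ erefl)[? [_ _]].
  exact: Flow_trace.
- move=> /accepts_step1_inv/(_ _ _ erefl)[d [d0 dE]].
  apply: Cnt_trace => //; rewrite /= !sym_eqE //=.
  move: dE; rewrite guard_xeq => /eqP ->.
  rewrite /load_bound /set_reg; case: ifP => _ /=.
    by rewrite x0E ratr_nat.
  by rewrite ratr_int.
Qed.

Definition simulator : pera 'I_#|{: sym N}| 'I_#|{: loc N}| 'I_2 :=
  rank_pera (@step D) Init (accepting D).

Definition nat_valuation (m n : nat) : param_valuation 'I_2 :=
  [ffun i => NngNum (ler0n rat (if i == ord0 then m else n))].

Lemma preservation_halts n :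
  language_preservation R simulator (nat_valuation n 0) <->
  exists t, halted D (iter t (machine_step D) (machine_input n)).
Proof.
have v0 : ((nat_valuation n 0) ord0)%:num = n%:R by rewrite ffunE.
have v1 : ((nat_valuation n 0) ord_max)%:num = 0 by rewrite ffunE.
rewrite rank_preservation; split=> [[v' [v'v H]]|[t halt]].
  (* The probe word with [n] ticks lies in both languages, and is accepted only if the first
     parameter is [n]. *)
  have v'0 : (v' ord0)%:num = n%:R.
    have : acc (nat_valuation n 0) Init (fun=> 0) (Probe :: rcons (nseq n Tick) Probe).
      by apply/accepts_Init_Probe; exists n; rewrite v0 ratr_nat.
    move=> /H /accepts_Init_Probe[m []] /(congr1 size).
    rewrite !size_rcons !size_nseq => -[<-] /eqP.
    by rewrite -(ratr_nat R) (inj_eq (fmorph_inj _)) => /eqP <-.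
  (* The two valuations can then differ only in the period, so that of [v'] is nonzero, and
     divergence would lose a [Start] word. *)
  apply: contrapT => /forallNP run.
  have [||u nacc] := @Start_diverging v' n v'0.
  - move=> v'1; apply: v'v; apply/ffunP => i; apply/val_inj => /=.
    have [->|->] : i = ord0 \/ i = ord_max.
      by case: i => [[|[|i]] i2] //; [left|right]; apply/val_inj.
    + by rewrite v'0 v0.
    + by rewrite v'1 v1.
  - by move=> t; apply/negP; exact: run.
  by apply: nacc; apply/H; exact: Start_period0.
(* The least period that [Start_halting] allows. *)
pose v' := nat_valuation n (n + t).+1.
exists v'; split.
  move=> /(congr1 (fun v : param_valuation 'I_2 => (v ord_max)%:num)).
  by rewrite v1 ffunE /= => /eqP; rewrite pnatr_eq0.
have Start_acc v u : v = v' \/ v = nat_valuation n 0 -> acc v Init (fun=> 0) (Start :: u).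
  case=> ->; last exact: Start_period0.
  apply: (@Start_halting _ n t) => //; first by rewrite ffunE.
  by rewrite ffunE /= ratr_nat.
move=> w; split=> acc_w; have [u [] wE] := accepts_Init acc_w; subst w.
- by apply: Start_acc; right.
- by move: acc_w; rewrite !accepts_Init_Probe !ffunE.
- by apply: Start_acc; left.
- by move: acc_w; rewrite !accepts_Init_Probe !ffunE.
Qed.

End Language.

(** * Register programs *)

Local Open Scope nat_scope.

Definition reach (M : machine) (c c' : machine_config) : Prop :=
  exists t, iter t (machine_step M) c = c'.

Lemma reach_refl M c : reach M c c.
Proof. by exists 0. Qed.

Lemma reach_trans M c c' c'' : reach M c c' -> reach M c' c'' -> reach M c c''.
Proof. by move=> [t <-] [t' <-]; exists (t' + t); rewrite iterD. Qed.

Lemma reach_step M c : reach M c (machine_step M c).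
Proof. by exists 1. Qed.

Lemma halted_iter M c t : halted M c -> iter t (machine_step M) c = c.
Proof. by move=> h; elim: t => //= t ->; rewrite /machine_step h. Qed.

Lemma reach_halts M c c' : reach M c c' ->
  (exists t, halted M (iter t (machine_step M) c)) <->
  (exists t, halted M (iter t (machine_step M) c')).
Proof.
move=> [u <-]; split=> -[t h]; last by exists (t + u); rewrite iterD.
by exists t; rewrite -iterD addnC iterD halted_iter.
Qed.

Lemma fetch_step (A B : machine) i s :
  machine_step (A ++ i :: B) (size A, s) =
  match i with
  | Inc r => ((size A).+1, set_reg s r (s r).+1)
  | Dec r k => if s r == 0 then (k, s) else ((size A).+1, set_reg s r (s r).-1)
  end.
Proof.
by rewrite /machine_step /halted size_cat /= addnS leqNgt ltnS leq_addr /= nth_cat ltnn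
  subnn.
Qed.

(** [Add r k] adds [k] to [r]; [Loop r p] decrements [r] and runs [p] as long as [r] is nonzero. *)
Inductive prog :=
  | Add of nat & nat
  | Seq of prog & prog
  | Loop of nat & prog.

Fixpoint psize (p : prog) : nat :=
  match p with
  | Add _ k => k
  | Seq p q => psize p + psize q
  | Loop _ p => (psize p).+2
  end.

(* An unconditional jump is a zero test of register 1, which programs never write. *)
Fixpoint compile (off : nat) (p : prog) : machine :=
  match p with
  | Add r k => nseq k (Inc r)
  | Seq p q => compile off p ++ compile (off + psize p) q
  | Loop r p => Dec r (off + (psize p).+2) :: compile off.+1 p ++ [:: Dec 1 off]
  end.

Fixpoint writes (p : prog) (r : nat) : bool :=
  match p with
  | Add r' _ => r' == r
  | Seq p q => writes p r || writes q r
  | Loop r' p => (r' == r) || writes p r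
  end.

(** A loop body must not write the counter, so that the number of iterations is known on entry, as
    in [exec]. *)
Fixpoint wf (p : prog) : bool :=
  match p with
  | Add _ _ => true
  | Seq p q => wf p && wf q
  | Loop r p => ~~ writes p r && wf p
  end.

Fixpoint exec (p : prog) (s : nat -> nat) : nat -> nat :=
  match p with
  | Add r k => set_reg s r (s r + k)
  | Seq p q => exec q (exec p s)
  | Loop r p => iter (s r) (fun s' => exec p (set_reg s' r (s' r).-1)) s
  end.

Lemma exec_Seq p q s : exec (Seq p q) s = exec q (exec p s).
Proof. by []. Qed.

Lemma exec_Loop r p s :
  exec (Loop r p) s = iter (s r) (fun s' => exec p (set_reg s' r (s' r).-1)) s.
Proof. by []. Qed.

Lemma size_compile off p : size (compile off p) = psize p.
Proof.
elim: p off => [r k|p IHp q IHq|r p IHp] off /=; first exact: size_nseq.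
  by rewrite size_cat IHp IHq.
by rewrite size_cat IHp addn1.
Qed.

Lemma set_reg_id s r : set_reg s r (s r) = s.
Proof. by apply/funext => x; rewrite /set_reg; case: eqP => [->|]. Qed.

Lemma exec_frame p s r : ~~ writes p r -> exec p s r = s r.
Proof.
elim: p s => [r' k|p IHp q IHq|r' p IHp] s /=.
- by rewrite /set_reg eq_sym => /negbTE->.
- by rewrite negb_or => /andP[np nq]; rewrite IHq // IHp.
rewrite negb_or => /andP[nr np]; elim: (s r') => //= k <-.
by rewrite IHp // /set_reg eq_sym (negbTE nr).
Qed.

Lemma compile_correct p A B s : wf p -> ~~ writes p 1 -> s 1 = 0 ->
  reach (A ++ compile (size A) p ++ B) (size A, s) (size A + psize p, exec p s).
Proof.
elim: p A B s => [r k|p IHp q IHq|r p IHp] A B s /=.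
- move=> _ _ _; elim: k A s => [|k IHk] A s.
    by rewrite !addn0 set_reg_id; exact: reach_refl.
  apply: reach_trans (reach_step _ _) _; rewrite /= fetch_step.
  have := IHk (rcons A (Inc r)) (set_reg s r (s r).+1).
  rewrite size_rcons cat_rcons addSnnS; congr (reach _ _ (_, _)).
  by apply/funext => x; rewrite /set_reg; case: eqP => // _; rewrite eqxx addSnnS.
- move=> /andP[wp wq]; rewrite negb_or => /andP[np nq] s1; rewrite -catA.
  apply: reach_trans (IHp _ _ _ wp np s1) _.
  have := IHq (A ++ compile (size A) p) B (exec p s) wq nq.
  by rewrite size_cat size_compile -catA addnA exec_frame //; apply.
move=> /andP[nr wp]; rewrite negb_or => /andP[r1 np] s1.
set M := (X in reach X); set off := size A.
have stepM : M = A ++ Dec r (off + (psize p).+2) :: (compile off.+1 p ++ Dec 1 off :: B).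
  by rewrite /M /= -catA.
have back s' : s' 1 = 0 -> machine_step M (off.+1 + psize p, s') = (off, s').
  move=> s'1; have -> : M = (A ++ Dec r (off + (psize p).+2) :: compile off.+1 p) ++
                           Dec 1 off :: B by rewrite stepM -catA.
  have -> : off.+1 + psize p =
      size (A ++ Dec r (off + (psize p).+2) :: compile off.+1 p).
    by rewrite size_cat /= size_compile addnS addSn.
  by rewrite fetch_step s'1.
(* Induction on the number [k] of iterations left, for all stores at the head of the loop. *)
move: {-2}(s r) (erefl (s r)) => k; elim: k s s1 => [|k IHk] s s1 sr.
  have := reach_step M (off, s); rewrite {2}stepM fetch_step -sr eqxx.
  by [].
rewrite iterSr -sr.
apply: reach_trans (reach_step _ _) _; rewrite {2}stepM fetch_step -sr /=.
set s' := set_reg s r k.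
have s'1 : s' 1 = 0 by rewrite /s' /set_reg eq_sym (negbTE r1).
have := IHp (rcons A (Dec r (off + (psize p).+2))) (Dec 1 off :: B) s' wp np s'1.
rewrite size_rcons cat_rcons -stepM => /reach_trans; apply.
apply: reach_trans (reach_step _ _) _; rewrite back ?exec_frame //.
by apply: IHk; rewrite exec_frame // /s' /set_reg eqxx.
Qed.

(** * A program that computes the code of an instance *)

Definition store (n a b t h : nat) : nat -> nat := nth 0 [:: n; 0; a; b; t; h].

(** Turns register updates into list updates, which reduce by computation. *)
Lemma set_reg_nth l r n : set_reg (nth 0 l) r n = nth 0 (set_nth 0 l r n).
Proof. by apply/funext => x; rewrite nth_set_nth. Qed.

Definition inputR := 0.
Definition headR := 2.
Definition codeR := 3.
Definition tempR := 4.
Definition holdR := 5.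

Definition transfer (r q : nat) : prog := Loop r (Add q 1).

Definition double : prog := Seq (Loop codeR (Add tempR 2)) (transfer tempR codeR).

(* One step of [code]: (a, code s) becomes code (a :: s) = 2^a (2 code s + 1). *)
Definition cons_code : prog :=
  Seq double (Seq (Add codeR 1) (Loop headR double)).

Definition copy_input : prog :=
  Seq (Loop inputR (Seq (Add headR 1) (Add tempR 1))) (transfer tempR inputR).

Lemma exec_transfer_temp_code n a b t h :
  exec (transfer tempR codeR) (store n a b t h) = store n a (b + t) 0 h.
Proof.
rewrite /= {1}/store /=; elim: t b => [|t IH] b; first by rewrite addn0.
by rewrite iterSr /store !set_reg_nth /= -/(store _ _ _ _ _) IH; congr store; lia.
Qed.

Lemma exec_double n a b h : exec double (store n a b 0 h) = store n a b.*2 0 h.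
Proof.
have loop t : exec (Loop codeR (Add tempR 2)) (store n a b t h) = store n a 0 (t + b.*2) h.
  rewrite /= {1}/store /=; elim: b t => [|b IH] t; first by rewrite addn0.
  rewrite iterSr /store !set_reg_nth /= -/(store _ _ _ _ _) IH; congr store; lia.
by rewrite /double exec_Seq loop exec_transfer_temp_code.
Qed.

Lemma exec_cons_code n a b h :
  exec cons_code (store n a b 0 h) = store n 0 (2 ^ a * b.*2.+1) 0 h.
Proof.
have loop b' : exec (Loop headR double) (store n a b' 0 h) = store n 0 (2 ^ a * b') 0 h.
  rewrite exec_Loop [store _ _ _ _ _ headR]/=.
  elim: a b' => [|a IH] b'; first by rewrite expn0 mul1n.
  rewrite iterSr {2 3}/store set_reg_nth [set_nth _ _ _ _]/= -/(store _ _ _ _ _).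
  by rewrite exec_double IH expnS; congr store; lia.
rewrite /cons_code exec_Seq exec_double exec_Seq -loop; congr (exec _ _).
by rewrite /= /store set_reg_nth /= addn1.
Qed.

Lemma exec_transfer_code_hold n a b t h :
  exec (transfer codeR holdR) (store n a b t h) = store n a 0 t (h + b).
Proof.
rewrite /= {1}/store /=; elim: b h => [|b IH] h; first by rewrite addn0.
by rewrite iterSr /store !set_reg_nth /= -/(store _ _ _ _ _) IH; congr store; lia.
Qed.

Lemma exec_transfer_hold_head n a b t h :
  exec (transfer holdR headR) (store n a b t h) = store n (a + h) b t 0.
Proof.
rewrite /= {1}/store /=; elim: h a => [|h IH] a; first by rewrite addn0.
by rewrite iterSr /store !set_reg_nth /= -/(store _ _ _ _ _) IH; congr store; lia.
Qed.

Lemma exec_transfer_input_head n a b t h :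
  exec (transfer inputR headR) (store n a b t h) = store 0 (a + n) b t h.
Proof.
rewrite /= {1}/store /=; elim: n a => [|n IH] a; first by rewrite addn0.
by rewrite iterSr /store !set_reg_nth /= -/(store _ _ _ _ _) IH; congr store; lia.
Qed.

Lemma exec_transfer_code_input n a b t h :
  exec (transfer codeR inputR) (store n a b t h) = store (n + b) a 0 t h.
Proof.
rewrite /= {1}/store /=; elim: b n => [|b IH] n; first by rewrite addn0.
by rewrite iterSr /store !set_reg_nth /= -/(store _ _ _ _ _) IH; congr store; lia.
Qed.

Lemma exec_copy_input n a b h :
  exec copy_input (store n a b 0 h) = store n (a + n) b 0 h.
Proof.
have move_ti m a' b' t h' :
    exec (transfer tempR inputR) (store m a' b' t h') = store (m + t) a' b' 0 h'.
  rewrite /= {1}/store /=; elim: t m => [|t IH] m; first by rewrite addn0.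
  by rewrite iterSr /store !set_reg_nth /= -/(store _ _ _ _ _) IH; congr store; lia.
have loop t : exec (Loop inputR (Seq (Add headR 1) (Add tempR 1))) (store n a b t h) =
              store 0 (a + n) b (t + n) h.
  rewrite /= {1}/store /=; elim: n a t => [|n IH] a' t; first by rewrite !addn0.
  by rewrite iterSr /store !set_reg_nth /= -/(store _ _ _ _ _) IH; congr store; lia.
by rewrite /copy_input exec_Seq loop move_ti.
Qed.

Lemma exec_add_head n a b t h k :
  exec (Add headR k) (store n a b t h) = store n (a + k) b t h.
Proof. by rewrite /= /store set_reg_nth. Qed.

(** Lists are coded from their last element, so the nested code is built inside out: [holdR] keeps a
    finished inner code while [codeR] restarts from 0, the code of the empty list. The input is
    copied first because it occurs twice. *)
Definition pair_encoder (k1 k0 : nat) : prog :=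
  foldr Seq (transfer codeR inputR)
    [:: copy_input; cons_code; cons_code; transfer codeR holdR;
        Add headR k1; cons_code; transfer holdR headR; cons_code;
        transfer codeR holdR; Add headR k0; cons_code; transfer holdR headR;
        cons_code; transfer codeR holdR; transfer holdR headR; cons_code;
        transfer inputR headR; cons_code].

Lemma exec_pair_encoder n k1 k0 : exec (pair_encoder k1 k0) (store n 0 0 0 0) =
  store (code [:: n; code [:: code [:: code [:: 0; n]; k1]; k0]]) 0 0 0 0.
Proof.
have execE := (exec_copy_input, exec_cons_code, exec_add_head, exec_transfer_code_hold,
  exec_transfer_hold_head, exec_transfer_input_head, exec_transfer_code_input).
rewrite /pair_encoder /foldr.
do 4 rewrite exec_Seq execE. 
do 4 rewrite exec_Seq execE. 
do 4 rewrite exec_Seq execE. 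
do 4 rewrite exec_Seq execE. 
do 2 rewrite exec_Seq execE. 
rewrite execE !add0n.
by [].
Qed.

(** * The diagonal machine *)

Lemma machine_stepE (P : machine) pc s : pc < size P ->
  machine_step P (pc, s) =
  match nth (Inc 0) P pc with
  | Inc r => (pc.+1, set_reg s r (s r).+1)
  | Dec r k => if s r == 0 then (k, s) else (pc.+1, set_reg s r (s r).-1)
  end.
Proof. by rewrite ltnNge /machine_step /halted => /negbTE->. Qed.

Section Diagonal.
Variable M : machine.

(** The [minn] sends every jump out of [M] to the first instruction after the relocated copy. *)
Definition relocate (off : nat) (i : instr) : instr :=
  match i with
  | Inc r => Inc r
  | Dec r k => Dec r (off + minn k (size M))
  end.

(** The constants code the denominator of the input, seen as a rational, and the zero period. *)
Definition encoder := pair_encoder (encode_int 1) (encode_rat 0).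

Definition esize := psize encoder.

Definition exit_pc := esize + size M.

(* After the relocated [M], halts if its output is 0, and otherwise loops for ever on
   the last instruction, since register 0 is 0 by then. *)
Definition diagonal : machine :=
  compile 0 encoder ++ [seq relocate (esize) i | i <- M] ++
  [:: Dec 0 exit_pc.+2; Dec 0 exit_pc.+1].

Lemma size_encoder : size (compile 0 encoder) = esize.
Proof. exact: size_compile. Qed.

Lemma size_diagonal : size diagonal = exit_pc.+2.
Proof. by rewrite /diagonal size_cat size_encoder size_cat size_map addnA addn2. Qed.

Lemma nth_diagonal_mid j : j < size M ->
  nth (Inc 0) diagonal (esize + j) = relocate (esize) (nth (Inc 0) M j).
Proof.
move=> jM; rewrite /diagonal nth_cat size_encoder ltnNge leq_addr /= addKn.
by rewrite nth_cat size_map jM (nth_map (Inc 0)).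
Qed.

Lemma nth_diagonal_exit j :
  nth (Inc 0) diagonal (exit_pc + j) =
  nth (Inc 0) [:: Dec 0 exit_pc.+2; Dec 0 exit_pc.+1] j.
Proof.
have -> : exit_pc + j = esize + (size M + j) by rewrite addnA.
rewrite /diagonal nth_cat size_encoder ltnNge leq_addr /= addKn.
by rewrite nth_cat size_map ltnNge leq_addr /= addKn.
Qed.

Definition embed (c : machine_config) : machine_config :=
  (esize + minn c.1 (size M), c.2).

Lemma embed_step c : reach diagonal (embed c) (embed (machine_step M c)).
Proof.
case: c => pc s; have [hc|] := boolP (halted M (pc, s)).
  by rewrite /machine_step hc; exact: reach_refl.
rewrite /halted -ltnNge /= => cM.
have -> : embed (pc, s) = (esize + pc, s) by rewrite /embed (minn_idPl (ltnW cM)).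
apply: (reach_trans (reach_step _ _)).
rewrite !machine_stepE ?size_diagonal ?nth_diagonal_mid //; last first.
  by rewrite /exit_pc; lia.
have E : (esize + pc).+1 = esize + minn pc.+1 (size M).
  by rewrite (minn_idPl cM) addnS.
case: (nth (Inc 0) M pc) => [r|r k]; first by rewrite /embed E; exact: reach_refl.
by rewrite /relocate; case: ifP => _; rewrite /embed ?E; exact: reach_refl.
Qed.

Lemma embed_iter t c : reach diagonal (embed c) (embed (iter t (machine_step M) c)).
Proof.
elim: t => [|t IH] /=; first exact: reach_refl.
exact: reach_trans IH (embed_step _).
Qed.

Lemma encode_nat_valuation n :
  encode_valuation (nat_valuation n 0) =
  code [:: code [:: code [:: 0; n]; encode_int 1]; encode_rat 0].
Proof.
rewrite /encode_valuation enum_ordSl enum_ordSl enum_ord0 /= !ffunE /=.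
rewrite /encode_rat -[n%:R%R]/(n%:~R)%R numq_int denq_int.
by rewrite [(0%N)%:R%R]/(0%R).
Qed.

Lemma diagonal_encodes n :
  reach diagonal (machine_input n)
    (embed (machine_input (code [:: n; encode_valuation (nat_valuation n 0)]))).
Proof.
have inputE m : machine_input m = (0, store m 0 0 0 0).
  congr pair; apply/funext => -[|[|[|[|[|[|x]]]]]] //=.
  by rewrite /store /= nth_nil.
have embedE m : embed (machine_input m) = (0 + esize, store m 0 0 0 0).
  by rewrite inputE /embed [X in minn X _](_ : _ = 0) // min0n addn0.
rewrite embedE inputE encode_nat_valuation -exec_pair_encoder.
exact: (@compile_correct encoder [::]).
Qed.

Lemma diagonal_halts n (b : bool) :
  outputs M (code [:: n; encode_valuation (nat_valuation n 0)]) b ->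
  (exists t, halted diagonal (iter t (machine_step diagonal) (machine_input n))) <-> ~~ b.
Proof.
move=> [t]; set c := iter t _ _ => -[halt cb].
have := reach_trans (diagonal_encodes n) (embed_iter t _); rewrite -/c.
have -> : embed c = (exit_pc, c.2) by rewrite /embed (minn_idPr halt).
move=> /reach_trans/(_ (reach_step _ _)).
rewrite machine_stepE ?size_diagonal // -[X in nth _ _ X]addn0 nth_diagonal_exit.
rewrite [X in reach _ _ X]/= cb.
case: b cb => cb /= /reach_halts ->; last first.
  by split=> // _; exists 0; rewrite /halted size_diagonal /=.
split=> // -[t'].
have fix_step s : s 0 = 0 ->
    machine_step diagonal (exit_pc.+1, s) = (exit_pc.+1, s).
  move=> s0; rewrite machine_stepE ?size_diagonal //.
  by rewrite -[X in nth _ _ X]addn1 nth_diagonal_exit /= s0.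
have -> : iter t' (machine_step diagonal) (exit_pc.+1, set_reg c.2 0 0) =
          (exit_pc.+1, set_reg c.2 0 0).
  by elim: t' => //= t' ->; rewrite fix_step.
by rewrite /halted size_diagonal /= ltnn.
Qed.

End Diagonal.

Theorem mainTheorem3 (R : realType) :
  ~ algorithmically_decidable encode_instance
      (fun i : lp_instance => @language_preservation R _ _ _ (lp_pera i) (lp_val i)).
Proof.
move=> [M dec]; pose A := simulator (diagonal M); pose n := encode_pera A.
(* As [n] is the code of [A], the code of this instance is by conversion the one that [diagonal M]
   passes to [M] on input [n]. *)
have [b [out bP]] := dec (LPInstance A (nat_valuation n 0)).
have := diagonal_halts out; rewrite -(preservation_halts _ R) -bP.
by case: b {out bP} => -[h1 h2]; [have := h1 isT | have := h2 isT].
Qed.
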